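(* Let $p\in\{1,2\}$ and let $G_2$ be the spider graph consisting of a center $v_0$ and three legs $v_0x_1x_2\cdots x_p$, $v_0y_1y_2\cdots y_p$, $v_0z_1z_2\cdots z_p$ (paths with $p$ vertices each besides $v_0$); write $x_0=y_0=z_0=v_0$. Let $H_1,\dots,H_{3p}$ be connected graphs, each with at least two vertices, with $m_i=|V(H_i)|$ ordered so that $m_1\le m_2\le\dots\le m_{3p}$. Let $\Gamma=G_2\diamond(H_1,\dots,H_{3p})$ be the generalized edge corona in which, for each $k\in\{0,1,\dots,p-1\}$, every vertex of $H_{3k+1}$ is joined to $x_{p-k}$ and $x_{p-k-1}$, every vertex of $H_{3k+2}$ is joined to $y_{p-k}$ and $y_{p-k-1}$, and every vertex of $H_{3k+3}$ is joined to $z_{p-k}$ and $z_{p-k-1}$. Then: (1) if $p=1$, $\Gamma$ is antimagic; (2) if $p=2$ and $\Delta(H_i)\le\delta(H_{i+1})$ for all $i\in\{1,\dots,5\}$, $d'(x_2)\le\delta'(H_2)$, $d'(y_2)\le\delta'(H_3)$ and $d'(z_2)\le\delta'(H_4)$, then $\Gamma$ is antimagic.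
   Context: All graphs are simple and undirected. A graph $G$ is antimagic if there is a bijection $f:E(G)\to\{1,2,\dots,|E(G)|\}$ such that the vertex sums $w(v)=\sum_{e\ni v}f(e)$ are pairwise distinct over all vertices $v$. For a graph $G$ with $m$ edges $e_1,\dots,e_m$ and graphs $H_1,\dots,H_m$, the generalized edge corona $G\diamond(H_1,\dots,H_m)$ is obtained from disjoint copies of $G,H_1,\dots,H_m$ by joining both end vertices of $e_i$ to every vertex of $H_i$, for each $i$. $\Delta(H)$ and $\delta(H)$ denote the maximum and minimum degree of $H$ itself. For a vertex $v$ of $\Gamma$, $d'(v)$ denotes its degree in $\Gamma$; $\delta'(H_i)$ denotes the minimum of $d'(v)$ over $v\in V(H_i)$ (so $d'(v)=\deg_{H_i}(v)+2$ for $v\in V(H_i)$). *)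

(* Defs.v *)
From mathcomp Require Import all_boot.
Set Implicit Arguments. Unset Strict Implicit. Unset Printing Implicit Defensive.

Section Graphs.
Variable V : finType.
Variable adj : rel V.

Definition edge_set : {set {set V}} :=
  [set e | [exists x, exists y, adj x y && (e == [set x; y])]].

Definition vsum (f : {set V} -> nat) (v : V) : nat :=
  \sum_(e in edge_set | v \in e) f e.

Definition antimagic : Prop :=
  exists f : {set V} -> nat,
    {in edge_set &, injective f} /\
    (forall e, e \in edge_set -> 1 <= f e <= #|edge_set|) /\
    injective (vsum f).

Definition deg (v : V) : nat := #|[set w | adj v w]|.

Definition simple_graph : Prop := irreflexive adj /\ symmetric adj.
End Graphs.

(* Base graph G on V with edges e_0,...,e_{n-1}, edge e_i having end vertices
   ends i; H_i is a graph on 'I_(sz i).  The vertex set of the corona is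
   V + {i & 'I_(sz i)}. *)
Definition corona_vertex (V : finType) (n : nat) (sz : 'I_n -> nat) :=
  (V + {i : 'I_n & 'I_(sz i)})%type.

Definition corona (V : finType) (G : rel V) (n : nat) (ends : 'I_n -> V * V)
  (sz : 'I_n -> nat) (H : forall i : 'I_n, rel 'I_(sz i)) :
  rel (@corona_vertex V n sz) :=
  fun a b =>
    match a, b with
    | inl x, inl y => G x y
    | inr s, inr t => (tag s == tag t) && H (tag s) (tagged s) (tagged_as s t)
    | inl x, inr t => (x == (ends (tag t)).1) || (x == (ends (tag t)).2)
    | inr s, inl y => (y == (ends (tag s)).1) || (y == (ends (tag s)).2)
    end.

(* None = center v0; Some (l, j) = vertex at distance j+1 from v0 on leg l
   (leg 0 = x, leg 1 = y, leg 2 = z). *)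
Definition spider_vertex (p : nat) := option ('I_3 * 'I_p).

Definition spider (p : nat) : rel (spider_vertex p) :=
  fun a b =>
    match a, b with
    | None, None => false
    | None, Some (_, j) => (j : nat) == 0
    | Some (_, j), None => (j : nat) == 0
    | Some (l, j), Some (l', j') =>
        (l == l') && (((j : nat).+1 == j') || ((j' : nat).+1 == j))
    end.

Definition leg (p : nat) (l : 'I_3) (d : nat) : spider_vertex p :=
  match d with
  | 0 => None
  | d'.+1 => match insub d' with Some j => Some (l, j) | None => None end
  end.

(* 0-based index i = 3k + l  (paper's H_{3k+l+1}) sits on the spider edge of
   leg l between distances p-k and p-k-1. *)
Definition spider_ends (p : nat) (i : 'I_(3 * p)) : spider_vertex p * spider_vertex p :=
  let k := i %/ 3 in
  let l := @inord 2 (i %% 3) in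
  (leg p l (p - k), leg p l (p - k - 1)).

Definition Gamma (p : nat) (sz : 'I_(3 * p) -> nat)
  (H : forall i : 'I_(3 * p), rel 'I_(sz i)) :=
  corona (@spider p) (@spider_ends p) H.

(* Main.v *)
Require Import Defs.
From mathcomp Require Import all_boot.
From mathcomp Require Import zify.
Set Implicit Arguments. Unset Strict Implicit. Unset Printing Implicit Defensive.

(* Edges are labelled layer by layer, and inside a layer in the order of the
   partial sums already accumulated at their ends.  Two vertices whose last
   edges lead to a common vertex c and lie in the same layer then get distinct
   sums: the one with the smaller partial sum also gets the smaller last label.
   Vertices of different kinds are separated by a degree argument: if
   deg u <= deg v and the edges at v lie in later layers than those at u, then
   the sum at u is smaller.

   For p = 1 the center is adjacent to every other vertex and its edges form
   the last layer.  For p = 2 the first layers are E(H_1), H_1-x2,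
   E(H_2), H_2-y2, E(H_3), H_3-z2; then, leg by leg, come the other edges
   between fibres and middle vertices and the edge joining tip and middle
   vertex (E(H_4), E(H_5), E(H_6) being put anywhere after H_3-z2), and finally
   all edges at v0.  The sums then increase along
   H_1 < x2 < H_2 < y2 < H_3 < z2 < (neighbours of v0) < v0. *)

(** The maximum M of [F] on [A] separates the two sums: the left one is at most [#|A|] times M, the
    right one at least [#|B|] times M. *)
Lemma leq_sum_card (T : finType) (A B : {set T}) (F G : T -> nat) :
  #|A| <= #|B| -> {in A & B, forall x y, F x <= G y} ->
  \sum_(x in A) F x <= \sum_(y in B) G y.
Proof.
move=> leAB leFG; apply: (@leq_trans (#|B| * \max_(x in A) F x)).
  apply: leq_trans (leq_mul leAB (leqnn _)).
  by rewrite -sum_nat_const; apply: leq_sum => x xA; apply: leq_bigmax_cond.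
rewrite -sum_nat_const; apply: leq_sum => y yB.
by apply/bigmax_leqP => x xA; apply: leFG.
Qed.

(** * Labelling a finite set layer by layer *)

Section LayeredLabelling.
Variables (T : finType) (E : {set T}) (g : T -> nat) (c : T -> T -> nat).

(** The weight that the layers strictly before that of [e] contribute to [e]. It is known before [e]
    itself is labelled, so it can serve as a sorting key. *)
Definition lower_sum (f : T -> nat) (e : T) : nat :=
  \sum_(e' in E | g e' < g e) c e e' * f e'.

(** Induction on the number of layers: the next layer is sorted by [lower_sum] and receives the next
    free labels in that order. *)
Lemma layered_labelling : exists f : T -> nat,
  [/\ {in E &, injective f},
      {in E, forall e, 1 <= f e <= #|E|},
      {in E &, forall e e', g e < g e' -> f e < f e'} &
      {in E &, forall e e', g e = g e' -> f e < f e' ->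
         lower_sum f e <= lower_sum f e'}].
Proof.
pose En n := [set e in E | g e < n].
suff H n : exists f : T -> nat,
  [/\ {in En n &, injective f},
      {in En n, forall e, 1 <= f e <= #|En n|},
      {in En n &, forall e e', g e < g e' -> f e < f e'} &
      {in En n &, forall e e', g e = g e' -> f e < f e' ->
         lower_sum f e <= lower_sum f e'}].
  have [f] := H (\max_(e in E) g e).+1.
  suff -> : En (\max_(e in E) g e).+1 = E by exists f.
  apply/setP => e; rewrite inE andb_idr // => eE.
  by rewrite ltnS; apply: leq_bigmax_cond.
elim: n => [|n [f [injf rngf monof sortf]]].
  by exists (fun=> 0); split=> e; rewrite inE ltn0 andbF.
pose Q := sort (fun e e' => lower_sum f e <= lower_sum f e')
               (enum [set e in E | g e == n]).
(* The labels up to [#|En n|] are taken; [index] starts at 0, hence the successor. *)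
pose h e := if g e < n then f e else #|En n| + (index e Q).+1.
have memQ e : (e \in Q) = (e \in E) && (g e == n).
  by rewrite mem_sort mem_enum inE.
have inEnS e : e \in En n.+1 -> (e \in En n) && (h e == f e) && (g e < n) ||
    [&& e \in Q, e \in E, g e == n & h e == #|En n| + (index e Q).+1].
  rewrite memQ !inE ltnS /h leq_eqVlt => /andP[eE].
  by case: (ltngtP (g e) n) => //=; rewrite eE ?eqxx.
(* Only labels of layers below [n] enter, where [h] and [f] agree, so the order already achieved
   persists. *)
have lowh e : g e <= n -> lower_sum h e = lower_sum f e.
  move=> gen; apply: eq_bigr => e' /andP[_ lt]; congr (_ * _).
  by rewrite /h (leq_trans lt gen).
have cardS : #|En n.+1| = #|En n| + size Q.
  rewrite size_sort -cardE -cardsUI.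
  rewrite [X in _ + X](_ : _ = 0) ?addn0.
    apply: eq_card => e; rewrite !inE -andb_orr ltnS leq_eqVlt orbC //.
  by apply: eq_card0 => e; rewrite !inE; case: ltngtP => //; rewrite ?andbF.
exists h; split.
- move=> e e' /inEnS/orP[/andP[/andP[eE /eqP->] _]|/and4P[eQ _ _ /eqP->]]
             /inEnS/orP[/andP[/andP[e'E /eqP->] _]|/and4P[e'Q _ _ /eqP->]].
  + exact: injf.
  + by move: (rngf _ eE) => H1 H2; exfalso; lia.
  + by move: (rngf _ e'E) => H1 H2; exfalso; lia.
  + by move=> /addnI[] eqi; apply: index_inj eqi.
- move=> e /inEnS/orP[/andP[/andP[eE /eqP->] _]|/and4P[eQ _ _ /eqP->]].
  + by move: (rngf _ eE); rewrite cardS; lia.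
  + by rewrite cardS leq_add2l index_mem eQ addnS.
- move=> e e' /inEnS/orP[/andP[/andP[eE /eqP->] lte]|/and4P[eQ _ /eqP ge /eqP->]]
             /inEnS/orP[/andP[/andP[e'E /eqP->] lte']|/and4P[e'Q _ /eqP ge' /eqP->]].
  + exact: monof.
  + by move: (rngf _ eE) => H1 _; lia.
  + by lia.
  + by lia.
- move=> e e' /inEnS/orP[/andP[/andP[eE /eqP->] lte]|/and4P[eQ _ /eqP ge /eqP->]]
             /inEnS/orP[/andP[/andP[e'E /eqP->] lte']|/and4P[e'Q _ /eqP ge' /eqP->]];
    try lia; rewrite !lowh; try lia.
  + exact: sortf.
  + rewrite ltn_add2l ltnS => _ lti.
    have sQ : sorted (fun e e' => lower_sum f e <= lower_sum f e') Q.
      by apply: sort_sorted => ? ?; apply: leq_total.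
    have := sorted_ltn_index (leT := fun e e' => lower_sum f e <= lower_sum f e') _ sQ.
    by apply=> // x y z; apply: leq_trans.
Qed.

End LayeredLabelling.

(** * Layered labellings of a graph *)

Section LayeredGraph.
Variables (V : finType) (adj : rel V).
Hypothesis simple : simple_graph adj.
Implicit Types (u v w a b : V) (f : {set V} -> nat).

Let adj_sym : symmetric adj := simple.2.

Lemma adj_neq u v : adj u v -> u != v.
Proof. by apply: contraTneq => ->; rewrite simple.1. Qed.

Lemma mem_edge_set u v : ([set u; v] \in edge_set adj) = adj u v.
Proof.
rewrite inE; apply/existsP/idP => [[x /existsP[y /andP[xy /eqP e]]]|uv].
  have := (set21 x y, set22 x y, set21 u v, set22 u v); rewrite -{1 2}e {3 4}e.
  case=> [[[/set2P xuv /set2P yuv] /set2P uxy] /set2P vxy].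
  have /eqP nxy := adj_neq xy.
  case: uxy xuv yuv => ->; case: vxy => -> //.
  - by move=> _ [] /esym.
  - by rewrite adj_sym.
  - by case.
by exists u; apply/existsP; exists v; rewrite uv eqxx.
Qed.

Lemma edgeP e : e \in edge_set adj -> exists u v, adj u v /\ e = [set u; v].
Proof.
by rewrite inE => /existsP[u /existsP[v /andP[uv /eqP->]]]; exists u, v.
Qed.

(** The map sending [w] to [[set v; w]] is a bijection from the neighbours of [v] to the edges at
    [v]. *)
Lemma sum_incident (P : pred {set V}) f v :
  \sum_(e in edge_set adj | (v \in e) && P e) f e =
  \sum_(w | adj v w && P [set v; w]) f [set v; w].
Proof.
rewrite -(big_imset (h := fun w => [set v; w]) f
            (A := [pred w | adj v w && P [set v; w]])) /=.
  apply: eq_bigl => e; apply/and3P/imsetP => [[eE ve Pe]|[w]].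
    have [a [b [ab eab]]] := edgeP eE; move: ve; rewrite eab => /set2P[] va.
      by exists b; rewrite // va -?eab // inE ab -eab.
    by exists a; rewrite va 1?setUC // inE adj_sym ab setUC -eab.
  by rewrite inE => /andP[vw Pvw] ->; rewrite mem_edge_set vw Pvw set21.
move=> w w' /andP[/adj_neq vw _] /andP[/adj_neq vw' _] /setP /(_ w).
by rewrite !inE eqxx orbT eq_sym (negPf vw) => /esym/eqP.
Qed.

Lemma vsum_neighbours f v : vsum adj f v = \sum_(w | adj v w) f [set v; w].
Proof.
rewrite /vsum -(eq_bigl _ _ (fun w => andbT (adj v w))).
by rewrite -(sum_incident xpredT); apply: eq_bigl => e; rewrite andbT.
Qed.

Variables (layer : V -> V -> nat).
Hypothesis layer_sym : forall u v, layer u v = layer v u.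

(** The maximum merely selects a value: by symmetry all ordered pairs representing [e] have the same
    layer. *)
Definition edge_layer (e : {set V}) : nat :=
  \max_(p : V * V | e == [set p.1; p.2]) layer p.1 p.2.

Lemma edge_layerE u v : edge_layer [set u; v] = layer u v.
Proof.
apply/anti_leq/andP; split; last first.
  exact: (leq_bigmax_cond (P := fun p : V * V => [set u; v] == [set p.1; p.2])
            (F := fun p => layer p.1 p.2) (u, v)).
apply/bigmax_leqP => -[x y] /= /eqP/setP e.
have := (e u, e v, e x, e y); rewrite !inE !eqxx !orbT /=.
case=> [[[/esym/orP[]/eqP-> /esym/orP[]/eqP->]]] /=; rewrite ?orbb.
- by move=> _ /eqP->.
- by [].
- by rewrite layer_sym.
- by move=> /eqP->.
Qed.

(** The edge to [c] is the last one at [u], so all other edges at [u] enter the key by which this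
    edge is sorted. *)
Definition layer_peak (u c : V) : Prop :=
  adj u c /\ forall w, adj u w -> w != c -> layer u w < layer u c.

(* [a] and [b] carry the strict inequality; the possible common edge [uv]
   cancels and is therefore left out of the comparison. *)
Definition dominated (u v : V) : Prop :=
  deg adj u <= deg adj v /\ exists a b,
    [/\ adj u a /\ adj v b, a != v, b != u, layer u a < layer v b &
        forall w w', adj u w -> adj v w' -> w != a -> w != v ->
          w' != b -> w' != u -> layer u w < layer v w'].

(** The edges [ua] and [vb] give the strict inequality, a common edge [uv] contributes equally to
    both sums, and [leq_sum_card] compares the rest. *)
Lemma dominated_vsum f u v :
  {in edge_set adj &, forall e e', edge_layer e < edge_layer e' -> f e < f e'} ->
  dominated u v -> vsum adj f u < vsum adj f v.
Proof.
move=> monof [ledeg [a [b [[ua vb] nav nbu ltab lt]]]].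
have lef x y x' y' : adj x y -> adj x' y' -> layer x y < layer x' y' ->
    f [set x; y] < f [set x'; y'].
  by move=> xy x'y' l; apply: monof; rewrite ?mem_edge_set ?edge_layerE.
rewrite !vsum_neighbours (bigD1 a) //= [X in _ < X](bigD1 b) //=.
rewrite -addSn leq_add ?lef //.
have [nva nub] : v != a /\ u != b by rewrite !(eq_sym _ a) !(eq_sym _ b).
pose Nu := [set w | [&& adj u w, w != a & w != v]].
pose Nv := [set w | [&& adj v w, w != b & w != u]].
(* Both degrees count the possible common edge as the same 0 or 1, so the comparison of degrees
   passes to [Nu] and [Nv]. *)
have cNu : #|Nu|.+1 + adj u v = deg adj u.
  rewrite /deg [in RHS](cardsD1 a) (cardsD1 v (_ :\ a)) !inE ua nva /=.
  suff -> : #|Nu| = #|[set w | adj u w] :\ a :\ v| by lia.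
  by apply: eq_card => w; rewrite !inE andbC andbA [(w != v) && _]andbC.
have cNv : #|Nv|.+1 + adj u v = deg adj v.
  rewrite /deg [in RHS](cardsD1 b) (cardsD1 u (_ :\ b)) !inE vb nub adj_sym /=.
  suff -> : #|Nv| = #|[set w | adj v w] :\ b :\ u| by lia.
  by apply: eq_card => w; rewrite !inE andbC andbA [(w != u) && _]andbC.
have leN : #|Nu| <= #|Nv| by move: ledeg; rewrite -cNu -cNv; lia.
have main : \sum_(w in Nu) f [set u; w] <= \sum_(w in Nv) f [set v; w].
  apply: leq_sum_card leN _ => x y; rewrite !inE => /and3P[ux xa xv] /and3P[vy yb yu].
  by apply/ltnW/lef => //; apply: lt.
rewrite (bigID (pred1 v)) /= [X in _ <= X](bigID (pred1 u)) /=.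
apply: leq_add.
  have [uv|nuv] := boolP (adj u v); last first.
    rewrite big1 // => w /andP[/andP[uw _] /eqP ew]; by rewrite -ew uw in nuv.
  rewrite (big_pred1 v) => [|w]; last first.
    by rewrite /= andbC; case: eqP => //= ->; rewrite uv nva.
  rewrite (big_pred1 u) => [|w]; last first.
    by rewrite /= andbC; case: eqP => //= ->; rewrite adj_sym uv nub.
  by rewrite setUC.
under eq_bigl do rewrite -andbA; under [X in _ <= X]eq_bigl do rewrite -andbA.
by move: main; rewrite (eq_bigl _ _ (fun w => in_set _ w))
  [X in _ <= X](eq_bigl _ _ (fun w => in_set _ w)).
Qed.

(** The number of common vertices. With this weight [lower_sum] at an edge is the sum of the partial
    sums at its two ends. *)
Definition incidence (e e' : {set V}) : nat := \sum_(x in e) (x \in e').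

Lemma lower_sum_edge f u v : adj u v ->
  lower_sum (edge_set adj) edge_layer incidence f [set u; v] =
  \sum_(w | adj u w && (layer u w < layer u v)) f [set u; w] +
  \sum_(w | adj v w && (layer v w < layer u v)) f [set v; w].
Proof.
move=> uv; rewrite /lower_sum edge_layerE /incidence.
under eq_bigr do rewrite big_setU1 ?inE ?adj_neq //= big_set1 mulnDl.
rewrite big_split /=.
have aux x : \sum_(e in edge_set adj | edge_layer e < layer u v) (x \in e) * f e =
  \sum_(w | adj x w && (layer x w < layer u v)) f [set x; w].
  under [RHS]eq_bigl do rewrite -edge_layerE.
  rewrite -(sum_incident (fun e => edge_layer e < layer u v)).
  rewrite (bigID (fun e : {set V} => x \in e)) /= [X in _ + X]big1 ?addn0; last first.
    by move=> e /andP[_ /negPf->].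
  under eq_bigl do rewrite -andbA [X in _ && X]andbC.
  by apply: eq_bigr => e /and3P[_ -> _]; rewrite mul1n.
by rewrite !aux.
Qed.

Lemma vsum_peak f u c : layer_peak u c ->
  vsum adj f u = f [set c; u] +
    \sum_(w | adj u w && (layer u w < layer u c)) f [set u; w].
Proof.
move=> [uc pk]; rewrite vsum_neighbours (bigD1 c) //= setUC; congr (_ + _).
apply: eq_bigl => w; apply: andb_id2l => uw.
by apply/idP/idP => [/(pk w uw)//|]; apply: contraTneq => ->; rewrite ltnn.
Qed.

(** Different ranks are separated by domination, chained through the intermediate ranks, all of
    which occur. Within one rank, two vertices share a peak [c], and the sorting of their edges to
    [c] decides. *)
Lemma antimagic_by_layers (rank : V -> nat) :
  (forall u v, u != v -> rank u = rank v ->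
     exists c, [/\ layer_peak u c, layer_peak v c & layer u c = layer v c]) ->
  (forall u v, rank v = (rank u).+1 -> dominated u v) ->
  (forall v k, k < rank v -> exists w, rank w = k) ->
  antimagic adj.
Proof.
move=> peaks doms ranks.
have [f [injf rngf monof sortf]] :=
  layered_labelling (edge_set adj) edge_layer incidence.
exists f; split; [|split] => //.
have rank_lt u v : rank u < rank v -> vsum adj f u < vsum adj f v.
  move E : (rank v) => n; elim: n v E => // n IH v E.
  rewrite ltnS leq_eqVlt => /predU1P[e|ltn].
    by apply: dominated_vsum => //; apply: doms; rewrite e.
  have [w wn] : exists w, rank w = n by apply: (ranks v); rewrite E.
  apply: ltn_trans (IH _ wn ltn) _.
  by apply: dominated_vsum => //; apply: doms; rewrite wn.
have rank_eq u v c : layer_peak u c -> layer_peak v c -> layer u c = layer v c ->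
    f [set c; u] < f [set c; v] -> vsum adj f u < vsum adj f v.
  move=> pu pv e lt; have [[uc _] [vc _]] := (pu, pv).
  rewrite (vsum_peak _ pu) (vsum_peak _ pv) -addSn leq_add //.
  (* Both keys contain the same partial sum at [c]; cancelling it leaves the comparison of the
     partial sums at [u] and [v]. *)
  have := sortf [set c; u] [set c; v].
  rewrite !mem_edge_set !edge_layerE ![adj c _]adj_sym ![layer c _]layer_sym.
  move/(_ uc vc e lt); rewrite !lower_sum_edge 1?adj_sym //.
  by rewrite ![layer c _]layer_sym e leq_add2l.
move=> u v eq_sum; apply/eqP/negPn/negP => nuv.
have [lt|lt|e] := ltngtP (rank u) (rank v).
- by have := rank_lt _ _ lt; rewrite eq_sum ltnn.
- by have := rank_lt _ _ lt; rewrite eq_sum ltnn.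
have [c [pu pv el]] := peaks _ _ nuv e.
have [[uc _] [vc _]] := (pu, pv).
have [lt|lt|ef] := ltngtP (f [set c; u]) (f [set c; v]).
- by have := rank_eq _ _ _ pu pv el lt; rewrite eq_sum ltnn.
- by have := rank_eq _ _ _ pv pu (esym el) lt; rewrite eq_sum ltnn.
have /setP/(_ u) : [set c; u] = [set c; v].
  by apply: injf; rewrite ?mem_edge_set 1?adj_sym.
by rewrite !inE eqxx orbT (negPf nuv) orbF (negPf (adj_neq uc)).
Qed.

End LayeredGraph.

(** * Graphs with a universal vertex *)

(** Two layers suffice: first the edges avoiding [c], then those at [c]. All vertices other than [c]
    have their peak at [c]; [d] witnesses that rank 0 occurs. *)
Lemma antimagic_universal (V : finType) (adj : rel V) (c d : V) :
  simple_graph adj -> d != c -> (forall v, v != c -> adj c v) ->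
  (forall v, v != c -> exists2 w, adj v w & w != c) -> antimagic adj.
Proof.
move=> simple dc univ escape.
apply: (@antimagic_by_layers V adj simple
  (fun u v => (u == c) || (v == c) : nat) _ (fun v => v == c : nat)).
- by move=> u v; rewrite orbC.
- move=> u v nuv e; exists c.
  have [uc vc] : u != c /\ v != c.
    by move: nuv e; have [->|] := eqVneq u c; have [|] := eqVneq v c.
  rewrite eqxx !orbT; split=> //; (split; first by rewrite simple.2 univ).
    by move=> w _ /negPf->; rewrite (negPf uc) eqxx orbT.
  by move=> w _ /negPf->; rewrite (negPf vc) eqxx orbT.
- move=> u v; have [-> |//] := eqVneq v c; have [//|uc] := eqVneq u c => _.
  split.
    apply: (@leq_trans #|[set~ u]|).
      by apply/subset_leq_card/subsetP => w; rewrite !inE eq_sym => /(adj_neq simple).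
    rewrite cardsC1 -(cardsC1 c); apply/subset_leq_card/subsetP => w.
    by rewrite !inE; apply: univ.
  (* The edge [ua] avoids [c] and lies in layer 0, while [ca] lies in layer 1. *)
  have [a ua ac] := escape _ uc; exists a, a; split.
  + by rewrite univ.
  + by [].
  + by rewrite eq_sym (adj_neq simple).
  + by rewrite eqxx (negPf uc) (negPf ac).
  + by move=> w w' _ _ _ /negPf-> _ _; rewrite eqxx (negPf uc).
- by move=> v k lt; exists d; rewrite (negPf dc); move: lt; case: eqP => //; case: k.
Qed.

(** * Degrees in the corona *)

Section CoronaDegree.
Variables (V : finType) (n : nat) (G : rel V) (ends : 'I_n -> V * V).
Variables (sz : 'I_n -> nat) (H : forall i : 'I_n, rel 'I_(sz i)).
Arguments H : clear implicits.

Lemma deg_sum (T : finType) (adj : rel T) v : deg adj v = \sum_w adj v w.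
Proof.
rewrite /deg cardsE -sum1_card big_mkcond; apply: eq_bigr => w _.
by rewrite unfold_in; case: adj.
Qed.

Lemma corona_simple : simple_graph G -> (forall i, simple_graph (H i)) ->
  simple_graph (corona G ends H).
Proof.
move=> [Girr Gsym] Hs; split=> [[x|[i x]]|[x|[i x]] [y|[j y]]] //=.
- by rewrite tagged_asE eqxx (Hs i).1.
- have [ij|//] := eqVneq i j.
  by case: j / ij y => y; rewrite !tagged_asE (Hs i).2.
Qed.

(** Distinct ends make the two indicators exclusive, so their sum agrees with the disjunction in
    [corona]. *)
Lemma deg_corona_inl x : (forall i, (ends i).1 != (ends i).2) ->
  deg (corona G ends H) (inl x) = deg G x +
    \sum_i ((x == (ends i).1) + (x == (ends i).2)) * sz i.
Proof.
move=> neq_ends; rewrite !deg_sum big_sumType /=; congr (_ + _).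
rewrite -(sig_big_dep xpredT (fun _ _ => true)
  (fun i _ => ((x == (ends i).1) || (x == (ends i).2) : nat))) /=.
apply: eq_bigr => i _; rewrite sum_nat_const card_ord mulnC; congr (_ * _).
by case: eqP => // ->; rewrite (negPf (neq_ends i)).
Qed.

Lemma deg_corona_inr t : (ends (tag t)).1 != (ends (tag t)).2 ->
  deg (corona G ends H) (inr t) = deg (H (tag t)) (tagged t) + 2.
Proof.
case: t => i x /= neq_ends; rewrite addn2 /deg.
pose emb (w : 'I_(sz i)) : corona_vertex V sz := inr (Tagged (fun i => 'I_(sz i)) w).
have inj_emb : injective emb.
  by move=> w w' [] /eqP; rewrite -tag_eqE /tag_eq /= eqxx tagged_asE => /eqP.
have embN (A : {set 'I_(sz i)}) y : (inl y \in emb @: A) = false.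
  by apply/imsetP => -[].
have -> : [set w | corona G ends H (inr (Tagged (fun i => 'I_(sz i)) x)) w] =
    inl (ends i).1 |: (inl (ends i).2 |: (emb @: [set w | H i x w])).
  apply/setP => -[y|[j y]]; rewrite !inE /=.
    rewrite (inj_eq (@inl_inj _ _)) (inj_eq (@inl_inj _ _)) orbA.
    by rewrite embN orbF.
  have [ij|nij] /= := eqVneq i j.
    by case: j / ij y => y; rewrite tagged_asE (mem_imset _ _ inj_emb) inE.
  apply/esym/imsetP => -[w _] [ji]; by rewrite ji eqxx in nij.
rewrite !cardsU1 !inE (inj_eq (@inl_inj _ _)) (negPf neq_ends) !embN.
by rewrite (card_imset _ inj_emb).
Qed.

End CoronaDegree.

(** * The spider and its corona *)

Lemma leg_Some p (l : 'I_3) d (dp : d < p) : leg p l d.+1 = Some (l, Ordinal dp).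
Proof. by rewrite /leg insubT. Qed.

Lemma spider_simple p : simple_graph (@spider p).
Proof.
split=> [[[l j]|]|[[l j]|] [[l' j']|]] //=; last by rewrite eq_sym orbC.
by rewrite eqxx; lia.
Qed.

Lemma Gamma_simple p (sz : 'I_(3 * p) -> nat) (H : forall i, rel 'I_(sz i)) :
  (forall i, simple_graph (H i)) -> simple_graph (Gamma H).
Proof. by move=> Hs; apply: corona_simple => //; apply: spider_simple. Qed.

Lemma Gamma_inl_inr p (sz : 'I_(3 * p) -> nat) (H : forall i, rel 'I_(sz i)) x t :
  Gamma H (inl x) (inr t) =
  (x == (spider_ends (tag t)).1) || (x == (spider_ends (tag t)).2).
Proof. by []. Qed.

Lemma Gamma_inr_inl p (sz : 'I_(3 * p) -> nat) (H : forall i, rel 'I_(sz i)) x t :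
  Gamma H (inr t) (inl x) =
  (x == (spider_ends (tag t)).1) || (x == (spider_ends (tag t)).2).
Proof. by []. Qed.

(** * Legs with one edge *)

Section OneEdgeLegs.
Variables (sz : 'I_(3 * 1) -> nat) (H : forall i, rel 'I_(sz i)).
Arguments H : clear implicits.
Hypotheses (Hsimple : forall i, simple_graph (H i)) (Hsize : forall i, 2 <= sz i).

(** Since ['I_(3 * 1)] is convertible to ['I_3], the index of a fibre is also the number of its
    leg. *)
Lemma spider_ends1 (i : 'I_(3 * 1)) : spider_ends i = (Some (i, ord0), None).
Proof.
have i3 : i < 3 := ltn_ord i.
rewrite /spider_ends modn_small // divn_small // inord_val (leg_Some _ (ltn0Sn 0)).
by congr (Some (_, _), _); apply: val_inj.
Qed.

Lemma antimagic_Gamma1 : antimagic (Gamma H).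
Proof.
pose leaf (l : 'I_3) : corona_vertex (spider_vertex 1) sz := inl (Some (l, ord0)).
apply: (@antimagic_universal _ _ (inl None) (leaf ord0)) => //.
- exact: Gamma_simple.
- move=> [[[l j]|]|t] // _; first by rewrite (ord1 j).
  by rewrite Gamma_inl_inr spider_ends1 eqxx orbT.
move=> [[[l j]|]|t] // _.
  (* A leaf avoids the center through its fibre, and a fibre vertex through its leaf. *)
  exists (inr (Tagged (fun i => 'I_(sz i)) (Ordinal (ltnW (Hsize l))))) => //.
  by rewrite Gamma_inl_inr spider_ends1 (ord1 j) eqxx.
by exists (leaf (tag t)) => //; rewrite Gamma_inr_inl spider_ends1 eqxx.
Qed.

End OneEdgeLegs.

(** * Legs with two edges: layers and ranks *)

Section TwoEdgeLegs.
Variables (sz : 'I_(3 * 2) -> nat) (H : forall i, rel 'I_(sz i)).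
Arguments H : clear implicits.
Hypotheses (Hsimple : forall i, simple_graph (H i)) (Hsize : forall i, 2 <= sz i).
Hypothesis Hsorted : forall i j : 'I_(3 * 2), i <= j -> sz i <= sz j.

Local Notation vertex := (corona_vertex (spider_vertex 2) sz).
Local Notation mid l := (Some (l, ord0) : spider_vertex 2).
Local Notation tip l := (Some (l, ord_max) : spider_vertex 2).

(** Fibre [l] sits on the outer edge of leg [l] and fibre [l + 3] on the inner one; numerical
    indices keep the case analysis arithmetical. *)
Definition touches (x : spider_vertex 2) (k : nat) : bool :=
  match x with
  | None => 3 <= k
  | Some (l, j) => (k == l) || (j == ord0) && (k == l + 3)
  end.

Lemma spider_ends2 (i : 'I_(3 * 2)) : spider_ends i =
  if i < 3 then (tip (inord i), mid (inord i)) else (mid (inord (i - 3)), None).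
Proof.
have i6 : i < 6 := ltn_ord i.
rewrite /spider_ends; case: ltnP => i3.
  rewrite modn_small // divn_small // -[2 - 0 - 1]/1 -[2 - 0]/2.
  rewrite (leg_Some _ (isT : 1 < 2)) (leg_Some _ (isT : 0 < 2)).
  by congr (Some (_, _), Some (_, _)); apply: val_inj.
have -> : i %/ 3 = 1 by lia.
have -> : i %% 3 = i - 3 by lia.
rewrite -[2 - 1 - 1]/0 -[2 - 1]/1 (leg_Some _ (isT : 0 < 2)).
by congr (Some (_, _), _); apply: val_inj.
Qed.

Lemma spider_ends2_neq (i : 'I_(3 * 2)) : (spider_ends i).1 != (spider_ends i).2.
Proof. by rewrite spider_ends2; case: ifP => //= _; apply/eqP => -[]. Qed.

Lemma touchesE x (i : 'I_(3 * 2)) :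
  (x == (spider_ends i).1) || (x == (spider_ends i).2) = touches x i.
Proof.
have i6 : i < 6 := ltn_ord i.
have inordE k (l : 'I_3) : k < 3 -> (l == inord k) = (k == l).
  by move=> k3; rewrite -val_eqE /= inordK // eq_sym.
rewrite spider_ends2; case: x => [[l j]|] /=; last by case: ltnP.
have [l3 j2] := (ltn_ord l, ltn_ord j).
case: ltnP => i3 /=; rewrite ?orbF !(inj_eq Some_inj) !xpair_eqE !inordE //; try lia.
all: by rewrite -!val_eqE /=; lia.
Qed.

(** On actual edges the symmetric forms [7 + l + l'] and [tag s + tag t] are [7 + 2 * l] and
    [2 * tag s]. Layers 0 to 5 alternate between an outer fibre and its edges to the tip, 6 to 11
    between the fibre edges and the tip edge at a middle vertex, and 12 is the center. The inner
    fibres fall into 6, 8 and 10. *)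
Definition layer2 (a b : vertex) : nat :=
  match a, b with
  | inl None, _ | _, inl None => 12
  | inl (Some (l, _)), inl (Some (l', _)) => 7 + l + l'
  | inl (Some (l, j)), inr _ | inr _, inl (Some (l, j)) =>
      if j == ord0 then 6 + 2 * l else 2 * l + 1
  | inr s, inr t => tag s + tag t
  end.

Lemma layer2_sym a b : layer2 a b = layer2 b a.
Proof. by case: a b => [[[l j]|]|s] [[[l' j']|]|t] //=; lia. Qed.

(** Outer fibres take ranks 0, 2, 4 and tips 1, 3, 5; the cap at 6 puts the inner fibres together
    with the middle vertices, the other neighbours of the center. *)
Definition rank2 (a : vertex) : nat :=
  match a with
  | inl None => 7
  | inl (Some (l, j)) => if j == ord0 then 6 else 2 * l + 1
  | inr t => minn 6 (2 * tag t)
  end.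

Lemma layer2_fiber_mid t l : layer2 (inr t) (inl (mid l)) = 6 + 2 * l.
Proof. by []. Qed.

Lemma layer2_fiber_tip t l : layer2 (inr t) (inl (tip l)) = 2 * l + 1.
Proof. by []. Qed.

Lemma layer2_tip_mid l l' : layer2 (inl (tip l)) (inl (mid l')) = 7 + l + l'.
Proof. by []. Qed.

Lemma layer2_lt12 (a b : vertex) : a != inl None -> b != inl None -> layer2 a b < 12.
Proof.
case: a b => [[[l j]|]|[i s]] // [[[l' j']|]|[i' t]] //= _ _.
- by have := ltn_ord l; have := ltn_ord l'; lia.
- by have := ltn_ord l; case: ifP; lia.
- by have := ltn_ord l'; case: ifP; lia.
- by have := ltn_ord i; have := ltn_ord i'; lia.
Qed.

Variant vertex2_spec : vertex -> nat -> Type :=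
  | VCenter : vertex2_spec (inl None) 7
  | VMid l : vertex2_spec (inl (mid l)) 6
  | VTip l : vertex2_spec (inl (tip l)) (2 * l + 1)
  | VInner (t : {i & 'I_(sz i)}) of 3 <= tag t : vertex2_spec (inr t) 6
  | VOuter (t : {i & 'I_(sz i)}) of tag t < 3 : vertex2_spec (inr t) (2 * tag t).

Lemma vertex2P a : vertex2_spec a (rank2 a).
Proof.
case: a => [[[l j]|]|t] /=; last 1 first.
- case: (ltnP (tag t) 3) => t3; [rewrite (minn_idPr _)|rewrite (minn_idPl _)]; try lia.
    exact: VOuter.
  exact: VInner.
- have [->|nj] := eqVneq j ord0; first exact: VMid.
  suff -> : j = ord_max by apply: VTip.
  by apply: val_inj; have := ltn_ord j; move: nj; rewrite -val_eqE /=; lia.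
- exact: VCenter.
Qed.

Lemma adj_inl_inr x t : Gamma H (inl x) (inr t) = touches x (tag t).
Proof. exact: touchesE. Qed.

Lemma adj_inr_inl x t : Gamma H (inr t) (inl x) = touches x (tag t).
Proof. exact: touchesE. Qed.

Lemma fiberE (j : 'I_2) (l : 'I_3) : Some (l, j) = mid l \/ Some (l, j) = tip l.
Proof.
by case: j => -[|[|//]] j2; [left|right]; congr (Some (_, _)); apply: val_inj.
Qed.

Lemma layer2_tip l w : Gamma H (inl (tip l)) w ->
  w = inl (mid l) \/ layer2 (inl (tip l)) w = 2 * l + 1.
Proof.
case: w => [[[l' j]|]|t] //; last by right.
by move=> /= /andP[/eqP<- j0]; left; case: (fiberE j l) => [->|[] ej] //; rewrite ej in j0.
Qed.

Lemma layer2_outer (t : {i & 'I_(sz i)}) (l : 'I_3) w : tag t = l :> nat ->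
  Gamma H (inr t) w ->
  [\/ w = inl (mid l), w = inl (tip l) | layer2 (inr t) w = 2 * l].
Proof.
move=> tl; case: w => [x|s]; last first.
  by move=> /= /andP[/eqP <- _]; constructor 3; lia.
rewrite adj_inr_inl tl; case: x => [[l' j]|] /=; have := ltn_ord l; last by lia.
move=> l3 ll'; have -> : l' = l by apply: val_inj; move: ll' => /=; lia.
by case: (fiberE j l) => ->; [constructor 1|constructor 2].
Qed.

(** This places the neighbours of the center above the last tip, whose edges to its fibre lie in
    layer 5. *)
Lemma layer2_ge6 u w : rank2 u = 6 -> Gamma H u w -> 6 <= layer2 u w.
Proof.
case: (vertex2P u) => // [l|l|t t3|t t3] e; try lia.
  by case: w => [[[l' j]|]|t] //= _; lia.
case: w => [x|s]; last by move=> /= /andP[/eqP <- _]; lia.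
rewrite adj_inr_inl; case: x => [[l' j]|] //=; have := ltn_ord l'.
by case: ifP; lia.
Qed.

Lemma adj_center u : rank2 u = 6 -> Gamma H u (inl None).
Proof.
by case: (vertex2P u) => // [l|t t3|t t3] e; rewrite ?adj_inr_inl //; lia.
Qed.

Lemma layer2_center u : layer2 u (inl None) = 12.
Proof. by case: u => [[[l j]|]|t]. Qed.

(** * Legs with two edges: degrees *)

Let S k := sz (inord k : 'I_(3 * 2)).

Lemma szE i : sz i = S i.
Proof. by rewrite /S inord_val. Qed.

Lemma leq_S k k' : k <= k' -> k' < 6 -> S k <= S k'.
Proof. by move=> le lt; apply: Hsorted; rewrite !inordK //; lia. Qed.

Lemma sum_touches x : \sum_i ((x == (spider_ends i).1) + (x == (spider_ends i).2)) * sz i =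
  \sum_(0 <= k < 6) touches x k * S k.
Proof.
rewrite big_mkord; apply: eq_bigr => i _; rewrite -szE -touchesE; congr (_ * _).
by case: eqP => // ->; rewrite (negPf (spider_ends2_neq i)).
Qed.

Lemma deg_tip l : deg (Gamma H) (inl (tip l)) = 1 + S l.
Proof.
rewrite deg_corona_inl; last exact: spider_ends2_neq.
congr (_ + _).
  rewrite /deg (_ : [set w | _] = [set mid l]) ?cards1 //.
  apply/setP => -[[l' j]|]; rewrite !inE //=.
  rewrite (inj_eq Some_inj) xpair_eqE eq_sym -val_eqE -(val_eqE j) /=.
  by have := ltn_ord j; lia.
rewrite sum_touches /index_iota /= !big_cons big_nil.
by case: l => -[|[|[|//]]] l3 /=; rewrite !(mul0n, mul1n, addn0, add0n).
Qed.

Lemma deg_mid l : deg (Gamma H) (inl (mid l)) = 2 + (S l + S (l + 3)).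
Proof.
rewrite deg_corona_inl; last exact: spider_ends2_neq.
congr (_ + _).
  rewrite /deg (_ : [set w | _] = [set None; tip l]) ?cards2 //.
  apply/setP => -[[l' j]|]; rewrite !inE //=.
  rewrite (inj_eq Some_inj) xpair_eqE eq_sym -val_eqE -(val_eqE j) /=.
  by have := ltn_ord j; lia.
rewrite sum_touches /index_iota /= !big_cons big_nil.
by case: l => -[|[|[|//]]] l3 /=; rewrite !(mul0n, mul1n, addn0, add0n).
Qed.

Lemma deg_center : deg (Gamma H) (inl None) = 3 + (S 3 + S 4 + S 5).
Proof.
rewrite deg_corona_inl; last exact: spider_ends2_neq.
congr (_ + _).
  rewrite /deg (_ : [set w | _] = (fun l => mid l) @: [set: 'I_3]).
    by rewrite card_imset ?cardsT ?card_ord // => l l' [].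
  apply/setP => -[[l j]|]; rewrite !inE //=; last by apply/esym/imsetP => -[].
  apply/eqP/imsetP => [j0|[l' _ [_ ->]] //].
  by exists l; rewrite ?inE //=; congr (Some (_, _)); apply: val_inj.
by rewrite sum_touches /index_iota /= !big_cons big_nil !(mul0n, mul1n, addn0, add0n) addnA.
Qed.

Lemma deg_fiber t : deg (Gamma H) (inr t) = deg (H (tag t)) (tagged t) + 2.
Proof. exact/deg_corona_inr/spider_ends2_neq. Qed.

Lemma deg_H_lt (i : 'I_(3 * 2)) u : deg (H i) u < sz i.
Proof.
rewrite -[X in _ < X]card_ord -cardsT; apply/proper_card/properP.
by split; [apply/subsetP => ?; rewrite !inE | exists u; rewrite !inE ?(Hsimple i).1].
Qed.

(** A vertex is not its own neighbour in the fibre, and two ends are added. For an outer fibre the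
    bound is exactly the degree of its tip. *)
Lemma deg_fiber_le t : deg (Gamma H) (inr t) <= 1 + S (tag t).
Proof.
by rewrite deg_fiber addn2 add1n ltnS (leq_trans (deg_H_lt _)) // szE.
Qed.

Lemma fiber_inhabited k : k < 6 -> exists t : {i & 'I_(sz i)}, tag t = k :> nat.
Proof.
by move=> k6; exists (Tagged (fun i => 'I_(sz i)) (Ordinal (ltnW (Hsize (Ordinal k6))))).
Qed.

(** * Vertices of equal rank *)

Lemma peak_center u : rank2 u = 6 -> layer_peak (Gamma H) layer2 u (inl None).
Proof.
move=> u6; split=> [|w _ nw]; first exact: adj_center.
by rewrite layer2_center layer2_lt12 //; apply: contra_eq_neq u6 => ->.
Qed.

Lemma peak_outer (t : {i & 'I_(sz i)}) (l : 'I_3) : tag t = l :> nat ->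
  layer_peak (Gamma H) layer2 (inr t) (inl (mid l)).
Proof.
move=> tl; split=> [|w tw nw]; first by rewrite adj_inr_inl /= tl eqxx.
rewrite layer2_fiber_mid.
by case: (layer2_outer tl tw) nw => ->; rewrite ?eqxx ?layer2_fiber_tip //; lia.
Qed.

(** Rank 6 has its peak at the center, an outer fibre at its middle vertex, and a tip is alone in
    its rank. *)
Lemma peaks2 u v : u != v -> rank2 u = rank2 v -> exists c,
  [/\ layer_peak (Gamma H) layer2 u c, layer_peak (Gamma H) layer2 v c &
      layer2 u c = layer2 v c].
Proof.
move=> nuv e; have [u6|u6] := eqVneq (rank2 u) 6.
  exists (inl None); rewrite !layer2_center.
  by split=> //; apply: peak_center; rewrite -?e.
case: (vertex2P u) e u6 nuv => // [|l|t t3] e _.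
- by case: (vertex2P v) e => [|l|l|t t3|t t3] //; try (have := ltn_ord l); lia.
- have l3 := ltn_ord l; case: (vertex2P v) e => [|l'|l'|t' t3'|t' t3'] e; try lia.
  by have -> : l = l' by [apply: val_inj => /=; lia]; rewrite eqxx.
- case: (vertex2P v) e => [|l'|l'|t' t3'|t' t3'] e; try lia.
  move=> _; have [l tl] : exists l : 'I_3, tag t = l :> nat by exists (Ordinal t3).
  have tl' : tag t' = l :> nat by lia.
  by exists (inl (mid l)); split=> //; apply: peak_outer.
Qed.

(** * Domination between consecutive ranks *)

Hypothesis Hdeg : forall i j : 'I_(3 * 2), (j : nat) = i.+1 -> i < 5 ->
  forall u w, deg (H i) u <= deg (H j) w.
Hypothesis Htip : forall (l : 'I_3) (t : {i & 'I_(sz i)}), tag t = l.+1 :> nat ->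
  deg (Gamma H) (inl (tip l)) <= deg (Gamma H) (inr t).

Lemma deg_fiber_mono (s t : {i & 'I_(sz i)}) : tag t = (tag s).+1 :> nat ->
  deg (Gamma H) (inr s) <= deg (Gamma H) (inr t).
Proof.
move=> e; rewrite !deg_fiber leq_add2r Hdeg //.
by move: (ltn_ord (tag t)); rewrite e.
Qed.

(** [Htip] treats the fibre just after the tip; [deg_fiber_mono] carries the bound on to every later
    fibre. *)
Lemma deg_tip_inner (l : 'I_3) (t : {i & 'I_(sz i)}) : l < tag t ->
  deg (Gamma H) (inl (tip l)) <= deg (Gamma H) (inr t).
Proof.
move E : (tag t : nat) => k; elim: k t E => // k IH t E.
rewrite ltnS leq_eqVlt => /predU1P[e|lt]; first by apply: Htip; rewrite E -e.
have [s sk] : exists s : {i & 'I_(sz i)}, tag s = k :> nat.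
  by apply: fiber_inhabited; have := ltn_ord (tag t); lia.
by apply: leq_trans (IH s sk lt) _; apply: deg_fiber_mono; rewrite E sk.
Qed.

Local Notation dominated2 := (dominated (Gamma H) layer2).

Lemma dominated_outer_tip (t : {i & 'I_(sz i)}) (l : 'I_3) : tag t = l :> nat ->
  dominated2 (inr t) (inl (tip l)).
Proof.
move=> tl; split; first by rewrite deg_tip -tl; apply: deg_fiber_le.
(* At the common middle vertex the layers are [6 + 2 * l] and [7 + 2 * l]; the remaining edges have
   layers [2 * l] and [2 * l + 1]. *)
exists (inl (mid l)), (inl (mid l)); split=> //.
- by rewrite adj_inr_inl /= tl !eqxx.
- by apply/eqP => -[].
- by rewrite layer2_fiber_mid layer2_tip_mid; lia.
move=> w w' tw lw' /eqP nw /eqP nw' /eqP nl _.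
case: (layer2_outer tl tw) => // ->.
by case: (layer2_tip lw') => // ->; rewrite addn1.
Qed.

Lemma dominated_tip_outer (l : 'I_3) (t : {i & 'I_(sz i)}) : tag t = l.+1 :> nat ->
  tag t < 3 -> dominated2 (inl (tip l)) (inr t).
Proof.
move=> tl t3; split; first exact: Htip.
have [l' tl'] : exists l' : 'I_3, tag t = l' :> nat by exists (Ordinal t3).
(* Here [l'] is [l + 1], so the layers are [7 + 2 * l] and [8 + 2 * l]. *)
exists (inl (mid l)), (inl (mid l')); split=> //.
- by rewrite adj_inr_inl /= tl' !eqxx.
- by apply/eqP => -[].
- by rewrite layer2_fiber_mid layer2_tip_mid; lia.
move=> w w' lw tw' /eqP nw _ /eqP nw' _.
case: (layer2_tip lw) => // ->.
by case: (layer2_outer tl' tw') => // ->; rewrite ?layer2_fiber_tip; lia.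
Qed.

Lemma dominated_tip_six (l : 'I_3) v : l = 2 :> nat -> rank2 v = 6 ->
  dominated2 (inl (tip l)) v.
Proof.
move=> l2 v6; split.
  case: (vertex2P v) v6 => // [l'|l'|t t3|t t3] e; try lia.
  - rewrite deg_tip deg_mid; have := @leq_S l (l' + 3); have := ltn_ord l'; lia.
  - by apply: deg_tip_inner; rewrite l2.
have [s sl] : exists s : {i & 'I_(sz i)}, tag s = l :> nat.
  by apply: fiber_inhabited; rewrite l2.
have rest w w' : Gamma H (inl (tip l)) w -> Gamma H v w' -> w != inl (mid l) ->
    layer2 (inl (tip l)) w < layer2 v w'.
  move=> lw vw' /eqP nw; case: (layer2_tip lw) => // ->.
  by have := layer2_ge6 v6 vw'; lia.
(* If [v] is the middle vertex of the same leg, the edge between tip and middle vertex is common, so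
   a fibre vertex must serve as [a]. *)
have [->|nv] := eqVneq v (inl (mid l)).
  exists (inr s), (inl None); split=> //.
  - by rewrite adj_inl_inr /= sl eqxx.
  - by rewrite layer2_sym layer2_fiber_tip layer2_center; have := ltn_ord l; lia.
  - move=> w w' lw lw' _ nw _ _; case: (layer2_tip lw) nw => ->; rewrite ?eqxx // l2 => _.
    exact: layer2_ge6 lw'.
exists (inl (mid l)), (inl None); split.
- by rewrite adj_center //= eqxx.
- by rewrite eq_sym.
- by [].
- by rewrite layer2_center layer2_tip_mid; have := ltn_ord l; lia.
- by move=> w w' lw vw' nw _ _ _; apply: rest.
Qed.

Lemma dominated_six_center v : rank2 v = 6 -> dominated2 v (inl None).
Proof.
move=> v6; split.
  rewrite deg_center; case: (vertex2P v) v6 => // [l|l|t t3|t t3] e; try lia.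
    (* [S l] is bounded by a summand other than [S (l + 3)]: by [S 4] if [l] is 0, by [S 3]
       otherwise. *)
    rewrite deg_mid; have := @leq_S l 3; have := @leq_S l 4.
    by case: l e => -[|[|[|//]]] l3 /=; rewrite ?(add0n, add1n, add2n); lia.
  apply: leq_trans (deg_fiber_le t) _; have t6 := ltn_ord (tag t).
  by move: (nat_of_ord (tag t)) t3 t6 => [|[|[|[|[|[|k]]]]]] // _ _; lia.
(* A common neighbour of [v] and the center: an inner fibre vertex for a middle vertex, and
   conversely. *)
have [a [va ca na]] : exists a, [/\ Gamma H v a, Gamma H (inl None) a & a != inl None].
  case: (vertex2P v) v6 => // [l|l|t t3|t t3] e; try lia.
    have [s sl] : exists s : {i & 'I_(sz i)}, tag s = l + 3 :> nat.
      by apply: fiber_inhabited; have := ltn_ord l; lia.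
    exists (inr s); rewrite !adj_inl_inr /= sl eqxx orbT; split=> //; lia.
  exists (inl (mid (inord (tag t - 3)))); rewrite adj_inr_inl /= inordK.
    by split=> //; lia.
  by have := ltn_ord (tag t); lia.
have nv : v != inl None by apply: contra_eq_neq v6 => ->.
have lt12 w w' : w != inl None -> layer2 v w < layer2 (inl None) w'.
  by move=> nw; rewrite (layer2_sym (inl None)) layer2_center layer2_lt12.
exists a, a; split=> //.
- apply: contraTneq va => ->; by rewrite (Gamma_simple Hsimple).1.
- exact: lt12.
- by move=> w w' _ _ _ nw _ _; apply: lt12.
Qed.

Lemma rank2_eq7 v : rank2 v = 7 -> v = inl None.
Proof.
by case: (vertex2P v) => // [l|t t3] e; try (have := ltn_ord l); lia.
Qed.

Lemma rank2_le7 v : rank2 v <= 7.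
Proof.
by case: (vertex2P v) => // [l|t t3]; try (have := ltn_ord l); lia.
Qed.

Lemma dominated_rank2 u v : rank2 v = (rank2 u).+1 -> dominated2 u v.
Proof.
have [u6 e|] := eqVneq (rank2 u) 6.
  by rewrite (@rank2_eq7 v) ?e ?u6 //; apply: dominated_six_center.
case: (vertex2P u) => // [|l|t t3] _ e.
- by have := rank2_le7 v; rewrite e.
- have l3 := ltn_ord l; have [v6|] := eqVneq (rank2 v) 6.
    by apply: dominated_tip_six => //; lia.
  case: (vertex2P v) e => // [|l'|t t3] e _; try lia.
  by apply: dominated_tip_outer => //; lia.
- case: (vertex2P v) e => [|l|l|s s3|s s3] e; try lia.
  by apply: dominated_outer_tip; lia.
Qed.

(** Even ranks below 6 come from outer fibres, odd ones from tips, by halving [k]. *)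
Lemma rank2_onto k : k < 7 -> exists w, rank2 w = k.
Proof.
rewrite ltnS leq_eqVlt => /predU1P[->|k6]; first by exists (inl (mid ord0)).
have := odd_double_half k; case: (odd k) => ek.
  have k3 : k./2 < 3 by lia.
  by exists (inl (tip (Ordinal k3))) => /=; lia.
have [|t tk] := @fiber_inhabited k./2; first by lia.
by exists (inr t) => /=; rewrite tk; lia.
Qed.

Lemma antimagic_Gamma2 : antimagic (Gamma H).
Proof.
apply: (antimagic_by_layers (Gamma_simple Hsimple) layer2_sym peaks2 dominated_rank2).
by move=> v k /leq_trans/(_ (rank2_le7 v)); apply: rank2_onto.
Qed.

End TwoEdgeLegs.

(* Indices are 0-based: H i for i : 'I_(3p) is the paper's H_{i+1}. *)
Theorem theorem2 (p : nat) (sz : 'I_(3 * p) -> nat)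
  (H : forall i : 'I_(3 * p), rel 'I_(sz i))
  (Hsimple : forall i, simple_graph (H i))
  (Hconn : forall i (u w : 'I_(sz i)), connect (H i) u w)
  (Hsize : forall i, 2 <= sz i)
  (Hsorted : forall i j : 'I_(3 * p), (i <= j)%N -> sz i <= sz j) :
  (p = 1 -> antimagic (Gamma H)) /\
  (p = 2 ->
     (forall (i j : 'I_(3 * p)), (j : nat) = i.+1 -> (i : nat) < 5 ->
        forall (u : 'I_(sz i)) (w : 'I_(sz j)), deg (H i) u <= deg (H j) w) ->
     (forall (i : 'I_(3 * p)), (i : nat) = 1 -> forall u : 'I_(sz i),
        deg (Gamma H) (inl (leg p (@inord 2 0) 2)) <= deg (Gamma H) (inr (Tagged _ u))) ->
     (forall (i : 'I_(3 * p)), (i : nat) = 2 -> forall u : 'I_(sz i),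
        deg (Gamma H) (inl (leg p (@inord 2 1) 2)) <= deg (Gamma H) (inr (Tagged _ u))) ->
     (forall (i : 'I_(3 * p)), (i : nat) = 3 -> forall u : 'I_(sz i),
        deg (Gamma H) (inl (leg p (@inord 2 2) 2)) <= deg (Gamma H) (inr (Tagged _ u))) ->
     antimagic (Gamma H)).
Proof.
split=> [p1|p2 Hdeg Hx Hy Hz]; subst p; first exact: antimagic_Gamma1.
apply: antimagic_Gamma2 => // l [i u] /= il.
have tipE : Some (l, ord_max) = leg 2 (inord l) 2.
  rewrite inord_val (leg_Some _ (isT : 1 < 2)).
  by congr (Some (_, _)); apply: val_inj.
rewrite tipE; move: il.
case: (nat_of_ord l) (ltn_ord l) => [|[|[|//]]] _ il.
- exact: Hx.
- exact: Hy.
- exact: Hz.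
Qed.
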